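(* Let $X \subset \mathbb R^n$ be a regular convex set, $f$ a projectively self-concordant barrier on $X$ with parameter $\gamma = \frac{\nu-2}{\sqrt{\nu-1}}$, $\nu \geq 2$, and $x_0 \in X^o$ a point. Let $F = \nu \cdot f$ and $G = f'' - f'f'^T$. Then the Dikin set \[ E^p_{f,x_0} = \left\{ x \in \mathbb R^n \,\left|\, 1 - f'(x_0)[x - x_0] > \sqrt{(\nu-1)G(x_0)[x - x_0,x - x_0]}\right. \right\} \] is convex, is contained in $X^o$, and contains the Dikin ellipsoid \[ E_{F,x_0} = \left\{ x \in \mathbb R^n \mid (x-x_0)^TF''(x_0)(x-x_0) < 1 \right\}. \]
   Context: A regular convex set $X \subset \mathbb R^n$ is a closed convex set with non-empty interior $X^o$ containing no lines; $\partial X$ is its boundary. A projectively self-concordant barrier on $X$ with parameter $\gamma \geq 0$ is a $C^3$ function $f: X^o \to \mathbb R$ such that: (1) $f''(x) - f'(x)f'(x)^T \succ 0$ (positive definite) for all $x \in X^o$; (2) $\lim_{x \to\partial X} f(x) = +\infty$, i.e. $f(x_k)\to+\infty$ whenever $x_k \in X^o$ converges to a point of $\partial X$; (3) $|f'''(x)[h,h,h] - 6f''(x)[h,h]f'(x)[h] + 4(f'(x)[h])^3| \leq 2\gamma(f''(x)[h,h] - (f'(x)[h])^2)^{3/2}$ for all $x \in X^o$, $h \in \mathbb R^n$. *)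

(* Defs.v *)
From HB Require Import structures.
From mathcomp Require Import all_boot all_order all_algebra.
From mathcomp Require Import all_classical all_reals all_analysis.

Set Implicit Arguments.
Unset Strict Implicit.
Unset Printing Implicit Defensive.

Import Order.TTheory GRing.Theory Num.Theory.
Import numFieldNormedType.Exports.

Local Open Scope classical_set_scope.
Local Open Scope ring_scope.

(* Points of R^n are column vectors. A function on the interior of X is a total
   function on R^n; only its values on the (open) interior of X are ever
   constrained, and derivatives at interior points depend on these only. *)

Record regular_convex_set (R : realType) (n : nat) (X : set 'cV[R]_n) : Prop :=
  RegularConvexSet {
    regular_closed : closed X;
    regular_convex : convex_set X;
    regular_interior : interior X !=set0;
    regular_no_line : forall x h : 'cV[R]_n, h != 0 ->
      ~ (forall t : R, X (x + t *: h))
  }.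

(* f is C^k on the open set U: f is C^(k+1) iff it is Frechet differentiable on
   U and x |-> f'(x)[v] is C^k on U for every fixed direction v. *)
Fixpoint Ck_on (R : realType) (n : nat) (k : nat) (U : set 'cV[R]_n)
    (f : 'cV[R]_n -> R) : Prop :=
  match k with
  | 0%N => forall x, U x -> {for x, continuous f}
  | k'.+1 => (forall x, U x -> differentiable f x) /\
             (forall v : 'cV[R]_n, Ck_on k' U ('D_v f))
  end.

(* f'(x)[h], f''(x)[h1, h2] and f'''(x)[h1, h2, h3] *)
Definition D1 (R : realType) (n : nat) (f : 'cV[R]_n -> R) (x h : 'cV[R]_n) : R :=
  'D_h f x.

Definition D2 (R : realType) (n : nat) (f : 'cV[R]_n -> R)
    (x h1 h2 : 'cV[R]_n) : R :=
  'D_h1 ('D_h2 f) x.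

Definition D3 (R : realType) (n : nat) (f : 'cV[R]_n -> R)
    (x h1 h2 h3 : 'cV[R]_n) : R :=
  'D_h1 ('D_h2 ('D_h3 f)) x.

(* f'(x) as a column vector and f''(x) as a matrix, i.e. the coordinates of
   D1 f x and D2 f x in the canonical basis *)
Definition gradient (R : realType) (n : nat) (f : 'cV[R]_n -> R) (x : 'cV[R]_n) :
    'cV[R]_n :=
  \col_i D1 f x (delta_mx i 0).

Definition hessian (R : realType) (n : nat) (f : 'cV[R]_n -> R) (x : 'cV[R]_n) :
    'M[R]_n :=
  \matrix_(i, j) D2 f x (delta_mx i 0) (delta_mx j 0).

(* A[h, k] = h^T A k *)
Definition mxform (R : realType) (n : nat) (A : 'M[R]_n) (h k : 'cV[R]_n) : R :=
  (h^T *m A *m k) 0 0.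

(* Only applied to matrices that are symmetric by Schwarz's theorem, so symmetry
   is not part of the definition. *)
Definition posdefmx (R : realType) (n : nat) (A : 'M[R]_n) : Prop :=
  forall h : 'cV[R]_n, h != 0 -> 0 < mxform A h h.

Definition Gmx (R : realType) (n : nat) (f : 'cV[R]_n -> R) (x : 'cV[R]_n) :
    'M[R]_n :=
  hessian f x - gradient f x *m (gradient f x)^T.

Record proj_self_concordant_barrier (R : realType) (n : nat) (X : set 'cV[R]_n)
    (gamma : R) (f : 'cV[R]_n -> R) : Prop := ProjSelfConcordantBarrier {
  psc_gamma_ge0 : 0 <= gamma;
  psc_C3 : Ck_on 3 (interior X) f;
  psc_posdef : forall x, interior X x -> posdefmx (Gmx f x);
  psc_barrier : forall (u : nat -> 'cV[R]_n) (p : 'cV[R]_n),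
    (forall k, interior X (u k)) -> (closure X `\` interior X) p ->
    u k @[k --> \oo] --> p -> f (u k) @[k --> \oo] --> +oo;
  psc_ineq : forall x h : 'cV[R]_n, interior X x ->
    `| D3 f x h h h - 6 * D2 f x h h * D1 f x h + 4 * D1 f x h ^+ 3 |
      <= 2 * gamma * (D2 f x h h - D1 f x h ^+ 2) `^ (3 / 2)
}.

Definition proj_dikin_set (R : realType) (n : nat) (nu : R)
    (f : 'cV[R]_n -> R) (x0 : 'cV[R]_n) : set 'cV[R]_n :=
  [set x | 1 - D1 f x0 (x - x0)
           > Num.sqrt ((nu - 1) * mxform (Gmx f x0) (x - x0) (x - x0))].

Definition dikin_ellipsoid (R : realType) (n : nat)
    (F : 'cV[R]_n -> R) (x0 : 'cV[R]_n) : set 'cV[R]_n :=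
  [set x | mxform (hessian F x0) (x - x0) (x - x0) < 1].

(* Main.v *)
(** Along a line x0 + t h put p = f'[h] and sigma = sqrt (f''[h,h] - f'[h]^2).
    The inequality on f''' reads |sigma' - 2 p sigma| <= gamma sigma^2, and
    p' = p^2 + sigma^2. For c = sqrt (nu - 1), the positive root of
    c^2 = 1 + c gamma, the function w = p + c sigma therefore satisfies the
    Riccati inequality w' <= w^2. The Dikin set is the set of x0 + h with
    w(0) < 1, for which w, hence p, stays bounded above for t <= 1; so f stays
    bounded above and, being a barrier, the segment cannot leave the interior
    of X. The inclusion of the ellipsoid comes from
    nu ((1 - p)^2 - (nu - 1)(q - p^2)) = (nu p - 1)^2 + (nu - 1)(1 - nu q),
    where q = f''[h,h]. *)

Require Import Defs.
From HB Require Import structures.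
From mathcomp Require Import all_boot all_order all_algebra.
From mathcomp Require Import all_classical all_reals all_analysis.
From mathcomp Require Import ring lra.
Import Order.TTheory GRing.Theory Num.Theory.
Import numFieldNormedType.Exports.
Local Open Scope classical_set_scope.
Local Open Scope ring_scope.

(** * First exit times and comparison for a scalar Riccati inequality *)

(** [T] is the infimum of the bad times. It is itself bad: otherwise a ball around it would lie in
    [A], yet bad times come arbitrarily close to the infimum. *)
Lemma first_exit {R : realType} (A : set R) (s : R) :
  A 0 -> (forall t, 0 <= t <= s -> A t -> nbhs t A) -> 0 <= s -> ~ A s ->
  exists T, [/\ 0 < T <= s, ~ A T & forall t, 0 <= t < T -> A t].
Proof.
move=> A0 openA s0 nAs.
pose S : set R := [set t | 0 <= t <= s /\ ~ A t].
have Ss : S s by split; rewrite ?s0 /=.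
have lbS : lbound S 0 by move=> t [/andP[]].
have infS : has_inf S by split; [exists s | exists 0].
have le_inf : forall t, S t -> inf S <= t.
  by move=> t St; apply: ge_inf => //; exact: infS.2.
have T0 : 0 <= inf S by apply: lb_le_inf => //; exists s.
have Ts : inf S <= s by exact: le_inf.
have nAT : ~ A (inf S).
  move=> /(openA _ (introT andP (conj T0 Ts)))/nbhs_ballP[e /= e0 Ae].
  have [t St lt_t] := inf_adherent e0 infS.
  apply: St.2; apply: Ae; rewrite /ball /= distrC ger0_norm ?subr_ge0 ?le_inf//.
  by rewrite ltrBlDl.
exists (inf S); split=> //.
  rewrite Ts andbT lt_neqAle T0 andbT; apply/eqP => T00.
  by apply: nAT; rewrite -T00.
move=> t /andP[t0 tT]; apply: contrapT => nAt.
have /le_inf : S t by split=> //; rewrite t0 /= (le_trans (ltW tT)).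
by rewrite leNgt tT.
Qed.

(** At the first time [T] where [d] fails to be negative, continuity forces [d T = 0]; a negative
    derivative there would make [d] positive just before [T]. *)
Lemma lt0_of_derive {R : realType} (d d' : R -> R) (s : R) :
  (forall t, 0 <= t <= s -> is_derive t (1 : R) d (d' t)) -> d 0 < 0 ->
  (forall t, 0 <= t <= s -> d t = 0 -> d' t < 0) -> 0 <= s -> d s < 0.
Proof.
move=> dd d0 dneg s0; rewrite ltNge; apply/negP => ds.
have cd t : 0 <= t <= s -> {for t, continuous d}.
  move=> ts; apply: differentiable_continuous; apply/derivable1_diffP.
  by have [] := dd t ts.
have [||//||T [/andP[T0 Ts] dT dlt]] := @first_exit _ [set t | d t < 0] s.
- by [].
- move=> t ts /= dt; by apply: (cvgr_lt _ (cd t ts)).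
- by move=> /=; apply/negP; rewrite -leNgt.
have Ts' : 0 <= T <= s by rewrite ltW.
have dT0 : d T = 0.
  apply/eqP; rewrite eq_le; apply/andP; split; last by rewrite leNgt; exact/negP.
  rewrite leNgt; apply/negP => dT'.
  have : nbhs T [set t | 0 < d t] by apply: (cvgr_gt _ (cd T Ts')).
  move=> /nbhs_ballP[e /= e0 He].
  pose t := Num.max 0 (T - e / 2).
  have tT : t < T by rewrite gt_max T0 /=; lra.
  have t0 : 0 <= t by rewrite le_max lexx.
  have et : T - e / 2 <= t by rewrite le_max lexx orbT.
  have : 0 < d t by apply: He; rewrite /ball /= ger0_norm; lra.
  by have := dlt t; rewrite t0 tT => /(_ isT) /= ? ?; lra.
have [dv eqd] := dd T Ts'.
have := dneg T Ts' dT0; rewrite -eqd => d'T.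
have : \forall u \near 0^', u^-1 *: ((d \o shift T) (u *: (1 : R)) - d T) < 0.
  by apply: (cvgr_lt _ dv).
rewrite near_withinE => /nbhs_ballP[e /= e0 He].
(* A backward increment, short enough to stay in the ball and to keep [u + T] nonnegative. As
   [u < 0], a negative quotient means [d (u + T) > 0]. *)
pose u := - Num.min T (e / 2).
have uT : - T <= u by rewrite lerN2 ge_min lexx.
have ue : - (e / 2) <= u by rewrite lerN2 ge_min lexx orbT.
have u0 : u < 0 by rewrite oppr_lt0 lt_min T0 /=; lra.
have : u^-1 *: (d (u *: (1 : R) + T) - d T) < 0.
  apply: He; last by rewrite lt_eqF.
  by rewrite /ball /= sub0r normrN ltr0_norm //; lra.
rewrite dT0 subr0 /GRing.scale /= mulr1 nmulr_rlt0 ?invr_lt0 // => du.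
have /= := dlt (u + T) (introT andP (conj _ _)); lra.
Qed.

(** The function a / (1 - b t) has derivative a b / (1 - b t)^2, which exceeds its square because a
    < b; b < 1 keeps it finite on [0, 1]. Clearing the denominator, wherever w (1 - b t) = a the
    derivative of the difference is at most w (a - b) < 0. *)
Lemma riccati_bound {R : realType} (w w' : R -> R) (a b s : R) :
  0 <= s <= 1 -> (forall t, 0 <= t <= s -> is_derive t (1 : R) w (w' t)) ->
  (forall t, 0 <= t <= s -> w' t <= w t ^+ 2) ->
  w 0 < a -> 0 < a -> a < b -> b < 1 -> w s < a / (1 - b).
Proof.
move=> /andP[s0 s1] dw leW w0 a0 ab b1.
suff ds : w s * (1 - b * s) - a < 0.
  rewrite ltr_pdivlMr ?subr_gt0 //.
  have [ws|ws] := leP (w s) 0.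
    have : w s * (1 - b) <= 0 by apply: mulr_le0_ge0; lra.
    lra.
  have : 0 <= w s * (b * (1 - s)) by rewrite !mulr_ge0 //; lra.
  lra.
(* Compares w with the strict supersolution a / (1 - b t). *)
apply: (@lt0_of_derive _ (fun t => w t * (1 - b * t) - a)
   (fun t => w' t * (1 - b * t) - b * w t)) => //; last 2 first.
- by rewrite mulr0 subr0 mulr1 subr_lt0.
- move=> t /[dup] ts /andP[t0 tS] dt; have := leW t ts => wt.
  have bt : 0 < 1 - b * t.
    have : 0 <= b * (1 - t) by rewrite mulr_ge0; lra.
    lra.
  have w1 : w t * (1 - b * t) = a by lra.
  have wt0 : 0 < w t by rewrite -(pmulr_lgt0 _ bt) w1.
  have : w' t * (1 - b * t) <= w t * a by rewrite -w1 mulrA -expr2 ler_pM2r.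
  nra.
move=> t ts; have dwt := dw t ts.
apply: is_derive_eq.
rewrite /GRing.scale /=; ring.
Qed.

Lemma proj_sc_slope_bound {R : realType} (p q r : R -> R) (c gamma a b s : R) :
  0 <= s <= 1 ->
  (forall t, 0 <= t <= s -> is_derive t (1 : R) p (q t)) ->
  (forall t, 0 <= t <= s -> is_derive t (1 : R) q (r t)) ->
  (forall t, 0 <= t <= s -> 0 < q t - p t ^+ 2) ->
  (forall t, 0 <= t <= s -> r t - 6 * q t * p t + 4 * p t ^+ 3 <=
     2 * gamma * Num.sqrt (q t - p t ^+ 2) ^+ 3) ->
  0 < c -> 1 + c * gamma = c ^+ 2 ->
  p 0 + c * Num.sqrt (q 0 - p 0 ^+ 2) < a -> 0 < a -> a < b -> b < 1 ->
  p s < a / (1 - b).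
Proof.
move=> /[dup] s01 /andP[s0 s1] dp dq G0 leG c0 cE w0 a0 ab b1.
pose sg t := Num.sqrt (q t - p t ^+ 2).
suff : p s + c * sg s < a / (1 - b).
  by apply: le_lt_trans; rewrite lerDl mulr_ge0 ?sqrtr_ge0 // ltW.
apply: (@riccati_bound _ (fun t => p t + c * sg t)
  (fun t => q t + c * ((r t - 2 * p t * q t) / (2 * sg t)))) => // t ts.
- have dpt := dp t ts; have dqt := dq t ts.
  have dG : is_derive t (1 : R) (fun t => q t - p t ^+ 2) (r t - 2 * p t * q t).
    by apply: is_derive_eq; rewrite /GRing.scale /=; ring.
  have dS := @is_derive1_sqrt _ (q t - p t ^+ 2) (G0 t ts).
  have dsg : is_derive t (1 : R) sg ((r t - 2 * p t * q t) / (2 * sg t)).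
    have dsg := @is_derive1_comp _ Num.sqrt (fun t => q t - p t ^+ 2) t _ _ dS dG.
    by apply: (@is_derive_eq _ _ _ _ _ _ _ _ dsg); rewrite mulrC.
  by apply: is_derive_eq; rewrite /GRing.scale /=; ring.
- have sg0 : 0 < sg t by rewrite sqrtr_gt0 G0.
  have sgE : q t = sg t ^+ 2 + p t ^+ 2 by rewrite sqr_sqrtr ?ltW ?G0 // subrK.
  (* With q = sg^2 + p^2 the hypothesis on [r] becomes r - 2 p q <= 4 p sg^2 + 2 gamma sg^3; divide
     by 2 sg. *)
  have le_r : (r t - 2 * p t * q t) / (2 * sg t) <= 2 * p t * sg t + gamma * sg t ^+ 2.
    have := leG t ts; rewrite -/(sg t) ler_pdivrMr ?mulr_gt0 // sgE; lra.
  have : 0 <= c * (2 * p t * sg t + gamma * sg t ^+ 2 -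
           (r t - 2 * p t * q t) / (2 * sg t)) by rewrite mulr_ge0 ?subr_ge0 // ltW.
  (* The choice of [c] enters here: c^2 sg^2 splits as sg^2, which completes p^2 to q, plus c gamma
     sg^2. *)
  have -> : (p t + c * sg t) ^+ 2 =
     q t + c * (2 * p t * sg t + gamma * sg t ^+ 2).
    transitivity (p t ^+ 2 + 2 * c * p t * sg t + c ^+ 2 * sg t ^+ 2); first by ring.
    by rewrite -cE sgE; ring.
  lra.
Qed.

(** * Derivatives along lines and in coordinates *)

Lemma is_derive_line {R : realType} {V : normedModType R} (f : V -> R)
    (x h : V) (t : R) :
  derivable f (x + t *: h) h ->
  is_derive t (1 : R) (fun t => f (x + t *: h)) ('D_h f (x + t *: h)).
Proof.
have E : (fun u : R => u^-1 *: (((fun t => f (x + t *: h)) \o shift t) (u *: (1 : R))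
            - f (x + t *: h))) =
         (fun u : R => u^-1 *: ((f \o shift (x + t *: h)) (u *: h) - f (x + t *: h))).
  apply/funext => u /=; congr (_ *: (f _ - _)).
  by rewrite [u *: (1 : R)]mulr1 scalerDl addrCA.
by move=> df; split; rewrite /derivable /derive E.
Qed.

Lemma derive_coord {R : realType} {n : nat} (f : 'cV[R]_n -> R) (x h : 'cV[R]_n) :
  differentiable f x -> 'D_h f x = \sum_i h i 0 * 'D_(delta_mx i 0) f x.
Proof.
move=> df; rewrite deriveE // [in LHS](matrix_sum_delta h) linear_sum.
apply: eq_bigr => i _; rewrite big_ord1 linearZ /=.
by rewrite deriveE.
Qed.

Lemma mxformE {R : realType} {n : nat} (A : 'M[R]_n) (h k : 'cV[R]_n) :
  mxform A h k = \sum_i h i 0 * \sum_j k j 0 * A i j.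
Proof.
rewrite /mxform -mulmxA mxE; apply: eq_bigr => i _; rewrite !mxE.
by congr (_ * _); apply: eq_bigr => j _; rewrite mulrC.
Qed.

(** The coordinate expansion of ['D_k f] is differentiated once more, so it has to hold on a whole
    neighbourhood of [x]. *)
Lemma mxform_hessian {R : realType} {n : nat} (f : 'cV[R]_n -> R)
    (x h k : 'cV[R]_n) :
  (\near x, differentiable f x) -> (forall v, differentiable ('D_v f) x) ->
  mxform (hessian f x) h k = D2 f x h k.
Proof.
move=> df d2f; rewrite mxformE /D2 derive_coord //; apply: eq_bigr => i _.
congr (_ * _).
have -> : 'D_(delta_mx i 0) ('D_k f) x =
    'D_(delta_mx i 0) (\sum_j k j 0 \*: 'D_(delta_mx j 0) f) x.
  apply: near_eq_derive; near=> y.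
  by rewrite fct_sumE derive_coord //; near: y.
rewrite derive_sum; last by move=> j; apply: derivableZ; exact: diff_derivable.
apply: eq_bigr => j _; rewrite !mxE deriveZ //; exact: diff_derivable.
Unshelve. all: by end_near.
Qed.

Lemma mxform_Gmx {R : realType} {n : nat} (f : 'cV[R]_n -> R)
    (x h : 'cV[R]_n) :
  (\near x, differentiable f x) -> (forall v, differentiable ('D_v f) x) ->
  mxform (Gmx f x) h h = D2 f x h h - D1 f x h ^+ 2.
Proof.
move=> df d2f; rewrite -mxform_hessian // /Gmx /mxform mulmxBr mulmxBl.
rewrite [LHS]mxE [X in _ + X]mxE; congr (_ - _).
rewrite -/(mxform _ h h) mxformE expr2 /D1.
rewrite derive_coord; last exact: nbhs_singleton df.
rewrite mulr_suml; apply: eq_bigr => i _; rewrite -mulrA; congr (_ * _).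
rewrite mulr_sumr; apply: eq_bigr => j _.
by rewrite !mxE big_ord1 !mxE /D1 mulrCA.
Qed.

Lemma mxform_hessianZ {R : realType} {n : nat} (f : 'cV[R]_n -> R) (a : R)
    (x h k : 'cV[R]_n) :
  (\near x, differentiable f x) -> (forall v, differentiable ('D_v f) x) ->
  mxform (hessian (fun y => a * f y) x) h k = a * mxform (hessian f x) h k.
Proof.
move=> df d2f.
suff -> : hessian (fun y => a * f y) x = a *: hessian f x.
  by rewrite /mxform -scalemxAr -scalemxAl mxE.
apply/matrixP => i j; rewrite !mxE /D2.
rewrite -[RHS](@deriveZ _ _ _ _ a); last exact: diff_derivable.
apply: near_eq_derive; near=> y.
rewrite -[RHS](@deriveMl _ _ f a) //; apply: diff_derivable; near: y; exact: df.
Unshelve. all: by end_near.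
Qed.

(** * Quadratic forms, convexity of the Dikin set, inclusion of the ellipsoid *)

Lemma mxform_lincomb {R : realType} {n : nat} (A : 'M[R]_n) (h k : 'cV[R]_n)
    (a b : R) :
  mxform A (a *: h + b *: k) (a *: h + b *: k) =
  a ^+ 2 * mxform A h h + a * b * (mxform A h k + mxform A k h) +
  b ^+ 2 * mxform A k k.
Proof.
rewrite /mxform.
have -> : (a *: h + b *: k)^T = a *: h^T + b *: k^T by rewrite linearD !linearZ.
rewrite !mulmxDl !mulmxDr -!scalemxAl -!scalemxAr !mxE; ring.
Qed.

Lemma mxform0 {R : realType} {n : nat} (A : 'M[R]_n) (h : 'cV[R]_n) :
  (mxform A h 0 = 0) * (mxform A 0 h = 0).
Proof. by split; rewrite /mxform ?trmx0 ?mulmx0 ?mul0mx mxE. Qed.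

Lemma posdefmx_ge0 {R : realType} {n : nat} (A : 'M[R]_n) (h : 'cV[R]_n) :
  posdefmx A -> 0 <= mxform A h h.
Proof.
by move=> pA; have [->|/pA/ltW//] := eqVneq h 0; rewrite mxform0.
Qed.

(** Cauchy-Schwarz for the symmetric part of [A], as [posdefmx] does not include symmetry. The form
    at be h - al k is nonnegative and equals al be times the difference of the two sides. *)
Lemma posdefmx_cauchy_schwarz {R : realType} {n : nat} (A : 'M[R]_n)
    (h k : 'cV[R]_n) : posdefmx A ->
  mxform A h k + mxform A k h
    <= 2 * Num.sqrt (mxform A h h) * Num.sqrt (mxform A k k).
Proof.
move=> pA.
have [->|h0] := eqVneq h 0; first by rewrite !mxform0 addr0 sqrtr0 mulr0 mul0r.
have [->|k0] := eqVneq k 0; first by rewrite !mxform0 addr0 sqrtr0 mulr0.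
set al := Num.sqrt (mxform A h h); set be := Num.sqrt (mxform A k k).
have al0 : 0 < al by rewrite sqrtr_gt0 pA.
have be0 : 0 < be by rewrite sqrtr_gt0 pA.
have := posdefmx_ge0 A (be *: h + (- al) *: k) pA; rewrite mxform_lincomb.
rewrite -(sqr_sqrtr (posdefmx_ge0 A h pA)) -(sqr_sqrtr (posdefmx_ge0 A k pA)).
rewrite -/al -/be => H.
rewrite -(ler_pM2l (mulr_gt0 al0 be0)); lra.
Qed.

Lemma sqrt_mxform_sublinear {R : realType} {n : nat} (A : 'M[R]_n)
    (h k : 'cV[R]_n) (a b : R) : posdefmx A -> 0 <= a -> 0 <= b ->
  Num.sqrt (mxform A (a *: h + b *: k) (a *: h + b *: k))
    <= a * Num.sqrt (mxform A h h) + b * Num.sqrt (mxform A k k).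
Proof.
move=> pA a0 b0; set al := Num.sqrt (mxform A h h).
set be := Num.sqrt (mxform A k k).
have : 0 <= a * al + b * be by rewrite addr_ge0 ?mulr_ge0 ?sqrtr_ge0.
move=> /ger0_norm <-; rewrite -sqrtr_sqr ler_wsqrtr // mxform_lincomb.
have := posdefmx_cauchy_schwarz A h k pA; rewrite -/al -/be.
move=> /(ler_wpM2l (mulr_ge0 a0 b0)).
rewrite -(sqr_sqrtr (posdefmx_ge0 A h pA)) -(sqr_sqrtr (posdefmx_ge0 A k pA)).
rewrite -/al -/be; lra.
Qed.

(** The set is a strict sublevel set of a linear form plus a multiple of the norm defined by
    [Gmx f x0]. *)
Lemma convex_proj_dikin_set {R : realType} {n : nat} (f : 'cV[R]_n -> R)
    (nu : R) (x0 : 'cV[R]_n) :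
  1 <= nu -> differentiable f x0 -> posdefmx (Gmx f x0) ->
  convex_set (proj_dikin_set nu f x0).
Proof.
move=> nu1 df pG; apply/convex_setW => x y /set_mem xD /set_mem yD l l0 l1.
apply/mem_set; move: xD yD; rewrite /proj_dikin_set /mkset.
have c0 : 0 <= nu - 1 by rewrite subr_ge0.
rewrite !(sqrtrM _ c0) => xD yD.
have -> : (conv l x y : 'cV[R]_n) - x0 =
    l%:num *: (x - x0) + (1 - l%:num) *: (y - x0).
  by rewrite !scalerBr addrACA -opprD -scalerDl subrKC scale1r.
have D1E : D1 f x0 (l%:num *: (x - x0) + (1 - l%:num) *: (y - x0)) =
    l%:num * D1 f x0 (x - x0) + (1 - l%:num) * D1 f x0 (y - x0).
  by rewrite /D1 !deriveE // linearD !linearZ.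
rewrite D1E.
move: (l%:num) l0 l1 => a a0 a1.
have b0 : 0 < 1 - a by rewrite subr_gt0.
have := sqrt_mxform_sublinear _ (x - x0) (y - x0) _ _ pG (ltW a0) (ltW b0).
move=> /(ler_wpM2l (sqrtr_ge0 (nu - 1))) /le_lt_trans; apply.
rewrite -(ltr_pM2l a0) in xD; rewrite -(ltr_pM2l b0) in yD.
have := ltrD xD yD; congr (is_true (_ < _)); ring.
Qed.

Lemma dikin_ellipsoid_sub_proj {R : realType} {n : nat} (f : 'cV[R]_n -> R)
    (nu : R) (x0 : 'cV[R]_n) : 2 <= nu -> posdefmx (Gmx f x0) ->
  (\near x0, differentiable f x0) -> (forall v, differentiable ('D_v f) x0) ->
  dikin_ellipsoid (fun x => nu * f x) x0 `<=` proj_dikin_set nu f x0.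
Proof.
move=> nu2 pG df d2f x; rewrite /dikin_ellipsoid /proj_dikin_set /=.
have := posdefmx_ge0 _ (x - x0) pG.
rewrite mxform_hessianZ // mxform_Gmx // mxform_hessian //.
set q := D2 _ _ _ _; set p := D1 _ _ _ => G0 qlt.
have nu0 : 0 < nu by lra.
(* Needed before squaring. If p >= 1, then nu q >= nu p^2 >= 2 p^2 >= 2, against nu q < 1. *)
have p1 : 0 < 1 - p.
  rewrite subr_gt0 ltNge; apply/negP => p1.
  have : 1 <= p ^+ 2 by rewrite exprn_ege1.
  have : 0 <= nu * (q - p ^+ 2) by rewrite mulr_ge0 // ltW.
  have : 0 <= (nu - 2) * p ^+ 2 by rewrite mulr_ge0 ?subr_ge0 ?sqr_ge0.
  lra.
rewrite -[ltRHS]ger0_norm ?(ltW p1) // -sqrtr_sqr ltr_sqrt ?exprn_gt0 //.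
rewrite -(ltr_pM2l nu0).
have : 0 <= (nu * p - 1) ^+ 2 by exact: sqr_ge0.
have : 0 < (nu - 1) * (1 - nu * q) by rewrite mulr_gt0; lra.
lra.
Qed.

(** * Inclusion of the Dikin set in the interior of [X] *)

Lemma line_continuous {R : realType} {V : normedModType R} (x h : V) :
  continuous (fun t : R => x + t *: h).
Proof. by move=> t; apply: cvgD; [exact: cvg_cst | exact: scalel_continuous]. Qed.

Lemma interior_exit {R : realType} {n : nat} (X : set 'cV[R]_n)
    (x0 h : 'cV[R]_n) : interior X x0 -> ~ interior X (x0 + h) ->
  exists T, [/\ 0 < T <= 1, ~ interior X (x0 + T *: h) &
    forall t, 0 <= t < T -> interior X (x0 + t *: h)].
Proof.
move=> Xx0 nXx.
apply: (@first_exit _ [set t | interior X (x0 + t *: h)]).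
- by rewrite /mkset scale0r addr0.
- by move=> t _ /nbhs_interior; apply: line_continuous.
- exact: ler01.
- by rewrite /mkset scale1r.
Qed.

Lemma barrier_unbounded {R : realType} {n : nat} (X : set 'cV[R]_n)
    (gamma : R) (f : 'cV[R]_n -> R) (x0 h : 'cV[R]_n) (T M : R) :
  proj_self_concordant_barrier X gamma f -> 0 < T ->
  (forall t, 0 <= t < T -> interior X (x0 + t *: h)) ->
  ~ interior X (x0 + T *: h) ->
  exists2 t, 0 <= t < T & M < f (x0 + t *: h).
Proof.
move=> Hf T0 XT nXT.
(* [harmonic k] is 1 / (k + 1), so [v] starts at 0 and tends to [T] while staying below it. *)
pose v k : R := T * (1 - harmonic k).
have v0T k : 0 <= v k < T.
  have h0 : 0 < harmonic k :> R by exact: harmonic_gt0.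
  have h1 : harmonic k <= 1 :> R by rewrite invf_le1 // ler1n.
  rewrite mulr_ge0 ?subr_ge0 ?(ltW T0) //= gtr_pMr //; lra.
have vT : v k @[k --> \oo] --> T.
  rewrite -[X in _ --> X]mulr1; apply: cvgM; first exact: cvg_cst.
  rewrite -[X in _ --> X]subr0; apply: cvgB; first exact: cvg_cst.
  exact: cvg_harmonic.
have uT : x0 + v k *: h @[k --> \oo] --> x0 + T *: h.
  exact: cvg_comp vT (line_continuous x0 h T).
have cl : closure X (x0 + T *: h).
  move=> B /uT [N _ NB]; exists (x0 + v N *: h); split.
    exact: interior_subset (XT _ (v0T N)).
  by apply: NB => /=.
have := psc_barrier Hf (fun k => XT _ (v0T k)) (conj cl nXT) uT.
by move=> /cvgryPgt/(_ M)[N _ NM]; exists (v N) => //; apply: NM => /=.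
Qed.

Lemma proj_sc_line_slope {R : realType} {n : nat} (X : set 'cV[R]_n)
    (f : 'cV[R]_n -> R) (nu a b T : R) (x0 h : 'cV[R]_n) :
  2 <= nu -> proj_self_concordant_barrier X ((nu - 2) / Num.sqrt (nu - 1)) f ->
  h != 0 -> T <= 1 -> (forall t, 0 <= t < T -> interior X (x0 + t *: h)) ->
  D1 f x0 h + Num.sqrt ((nu - 1) * mxform (Gmx f x0) h h) < a ->
  0 < a -> a < b -> b < 1 ->
  forall t, 0 <= t < T -> D1 f (x0 + t *: h) h < a / (1 - b).
Proof.
move=> nu2 [_ [df C2] pG _ sc] h0 T1 XT w0 a0 ab b1 s /andP[s0 sT].
have XTs t : 0 <= t <= s -> interior X (x0 + t *: h).
  by move=> /andP[t0 ts]; apply: XT; rewrite t0 (le_lt_trans ts).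
have GE y : interior X y -> mxform (Gmx f y) h h = D2 f y h h - D1 f y h ^+ 2.
  move=> Xy; apply: mxform_Gmx; last by move=> v; exact: (C2 v).1.
  by apply: filterS df _; exact: nbhs_interior.
have G0 t : 0 <= t <= s ->
    0 < D2 f (x0 + t *: h) h h - D1 f (x0 + t *: h) h ^+ 2.
  by move=> /XTs Xt; rewrite -GE //; exact: pG.
have nu1 : 0 < nu - 1 by lra.
have c0 : 0 < Num.sqrt (nu - 1) by rewrite sqrtr_gt0.
apply: (@proj_sc_slope_bound _ (fun t => D1 f (x0 + t *: h) h)
  (fun t => D2 f (x0 + t *: h) h h) (fun t => D3 f (x0 + t *: h) h h h)
  (Num.sqrt (nu - 1)) ((nu - 2) / Num.sqrt (nu - 1)) a b s _ _ _ G0 _ c0 _ _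
  a0 ab b1).
- by rewrite s0 (le_trans (ltW sT)).
- by move=> t /XTs Xt; apply/is_derive_line/diff_derivable/(C2 h).1.
- by move=> t /XTs Xt; apply/is_derive_line/diff_derivable/((C2 h).2 h).1.
- move=> t ts; apply: le_trans (ler_norm _) _; apply: le_trans (sc _ _ (XTs t ts)) _.
  (* Turns the real power 3/2 into the cube of a square root. *)
  rewrite (_ : 3 / 2 = 2^-1 * 3%:R :> R); last by rewrite mulrC.
  by rewrite powRrM powR12_sqrt ?powR_mulrn ?sqrtr_ge0 // ltW // G0.
(* For c = sqrt (nu - 1), c gamma = nu - 2, hence 1 + c gamma = nu - 1 = c^2. *)
- by rewrite mulrCA divff ?gt_eqF // mulr1 sqr_sqrtr ?(ltW nu1) //; ring.
- have X0 : interior X x0 by have := XTs 0; rewrite scale0r addr0 lexx s0; exact.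
  by rewrite scale0r addr0 -GE // -sqrtrM // ltW.
Qed.

(** If the segment left the interior at a first time T <= 1, the uniform slope bound on [0, T) and
    the mean value theorem would bound [f] there, against [barrier_unbounded]. *)
Lemma proj_dikin_set_sub_interior {R : realType} {n : nat} (X : set 'cV[R]_n)
    (f : 'cV[R]_n -> R) (nu : R) (x0 : 'cV[R]_n) :
  2 <= nu -> proj_self_concordant_barrier X ((nu - 2) / Num.sqrt (nu - 1)) f ->
  interior X x0 -> proj_dikin_set nu f x0 `<=` interior X.
Proof.
move=> nu2 Hf Xx0 x; rewrite /proj_dikin_set /=.
(* The slope bound needs a nonzero direction, so that positive definiteness gives sigma > 0. *)
have [/subr0_eq -> //|h0] := eqVneq (x - x0) 0.
move=> Dx; apply: contrapT => nXx.
have [|T [/andP[T0 T1] nXT XT]] := @interior_exit _ _ X x0 (x - x0) Xx0.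
  by rewrite subrKC.
move: Dx h0 nXT XT; move: (x - x0) => h Dx h0 nXT XT.
(* Truncating w(0) at 0 makes [a] positive; [a] and [b] then cut the interval from [m] to 1 into
   thirds. *)
pose m := Num.max 0 (D1 f x0 h + Num.sqrt ((nu - 1) * mxform (Gmx f x0) h h)).
have m0 : 0 <= m by rewrite le_max lexx.
have m1 : m < 1 by rewrite gt_max ltr01 /=; lra.
have wm : D1 f x0 h + Num.sqrt ((nu - 1) * mxform (Gmx f x0) h h) <= m.
  by rewrite le_max lexx orbT.
pose a := (2 * m + 1) / 3; pose b := (m + 2) / 3.
have [a0 ma ab b1] : [/\ 0 < a, m < a, a < b & b < 1].
  by split; rewrite /a /b; lra.
have slope := @proj_sc_line_slope _ _ X f nu a b T x0 h nu2 Hf h0 T1 XT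
  (le_lt_trans wm ma) a0 ab b1.
have M0 : 0 < a / (1 - b) by rewrite divr_gt0 // subr_gt0.
have [t tT] := barrier_unbounded _ _ _ _ _ _ (f x0 + a / (1 - b)) Hf T0 XT nXT.
apply/negP; rewrite -leNgt; move: tT => /andP[t0 tT].
pose g s := f (x0 + s *: h); pose dg s := D1 f (x0 + s *: h) h.
have gP s : s \in `[0, t] -> is_derive s (1 : R) g (dg s).
  rewrite in_itv /= => /andP[s0 st]; apply/is_derive_line/diff_derivable.
  by apply: (psc_C3 Hf).1; apply: XT; rewrite s0 (le_lt_trans st).
have g_cont : {within `[0, t], continuous g}.
  by apply: derivable_within_continuous => s /gP[].
have g_der s : s \in `]0, t[ -> is_derive s (1 : R) g (dg s).
  by move=> /subset_itv_oo_cc; exact: gP.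
have [s] := @MVT_segment R g dg 0 t t0 g_der g_cont.
rewrite in_itv /= subr0 {1 2}/g scale0r addr0 => /andP[s0 st] E.
have := slope s; rewrite s0 (le_lt_trans st tT) => /(_ isT) ls.
rewrite -lerBlDl E.
apply: (@le_trans _ _ (a / (1 - b) * t)); first by rewrite ler_wpM2r // ltW.
by rewrite ger_pMr // (le_trans (ltW tT)).
Qed.

Theorem lemma3p4 (R : realType) (n : nat) (X : set 'cV[R]_n)
    (f : 'cV[R]_n -> R) (nu : R) (x0 : 'cV[R]_n)
    (HX : regular_convex_set X) (Hnu : 2 <= nu)
    (Hf : proj_self_concordant_barrier X ((nu - 2) / Num.sqrt (nu - 1)) f)
    (Hx0 : interior X x0) :
  convex_set (proj_dikin_set nu f x0) /\
  proj_dikin_set nu f x0 `<=` interior X /\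
  dikin_ellipsoid (fun x => nu * f x) x0 `<=` proj_dikin_set nu f x0.
Proof.
have [df C2] := psc_C3 Hf; have pG := psc_posdef Hf Hx0.
split; [|split].
- by apply: convex_proj_dikin_set => //; [lra | exact: df].
- exact: proj_dikin_set_sub_interior.
- apply: dikin_ellipsoid_sub_proj => //; last by move=> v; exact: (C2 v).1.
  by apply: filterS df _; exact: nbhs_interior.
Qed.
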